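(* Let $f\colon\mathbb{R}^n\to\mathbb{R}$ be continuously differentiable, let $M\subset\mathbb{R}^n$ be closed, and let $K\colon\mathbb{R}^n\rightrightarrows\mathbb{R}^m$ be a set-valued mapping with closed graph. Consider $$(\mathrm P)\quad \min_z\{f(z)\mid z\in M\cap\operatorname{dom}K\},\qquad (\mathrm Q)\quad \min_{z,\lambda}\{f(z)\mid z\in M,\ (z,\lambda)\in\operatorname{gph}K\},$$ and the set-valued mappings $\Upsilon_{\mathrm{imp}}(z):=(z,z)-M\times\operatorname{dom}K$ and $\Upsilon_{\mathrm{exp}}(z,\lambda):=(z,z,\lambda)-M\times\operatorname{gph}K$. Let $\bar z$ be a feasible point of $(\mathrm P)$ at which $K$ is inner semicompact w.r.t. $\operatorname{dom}K$. Then the following hold. (a) If $\bar z$ is an implicit local minimizer of $(\mathrm P)$, then it is abstractly M-stationary. (b) If $\bar z$ is an implicit local minimizer of $(\mathrm P)$ and if $\Upsilon_{\mathrm{imp}}$ is metrically subregular at $(\bar z,(0,0))$, then $\bar z$ is implicitly M-stationary. (c) If, for some $\bar\lambda\in K(\bar z)$, $(\bar z,\bar\lambda)$ is a local minimizer of $(\mathrm Q)$ and if $\Upsilon_{\mathrm{exp}}$ is metrically subregular at $((\bar z,\bar\lambda),(0,0,0))$, then $\bar z$ is explicitly M-stationary w.r.t. $\bar\lambda$. (d) If $\bar z$ is an explicit local minimizer of $(\mathrm P)$ and if $\Upsilon_{\mathrm{exp}}$ is metrically subregular at $((\bar z,\bar\lambda),(0,0,0))$ for each $\bar\lambda\in K(\bar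 z)$, then $\bar z$ is explicitly M-stationary.
   Context: $\operatorname{gph}K:=\{(z,\lambda)\mid\lambda\in K(z)\}$, $\operatorname{dom}K:=\{z\mid K(z)\neq\emptyset\}$; $\|\cdot\|$ is the Euclidean norm. For $\Omega\subset\mathbb{R}^n$ locally closed around $\bar z\in\Omega$: the regular normal cone is $\widehat N_\Omega(\bar z):=\{\zeta\mid\zeta^\top(z-\bar z)\le o(\|z-\bar z\|)\ \forall z\in\Omega\}$; the limiting normal cone $N_\Omega(\bar z)$ is the set of all $\zeta$ for which there are $z_k\to\bar z$, $z_k\in\Omega$, and $\zeta_k\to\zeta$ with $\zeta_k\in\widehat N_\Omega(z_k)$ for all $k$. Limiting coderivative: $D^*K(\bar z,\bar\lambda)(y^* ):=\{x^*\in\mathbb{R}^n\mid(x^*,-y^* )\in N_{\operatorname{gph}K}(\bar z,\bar\lambda)\}$. $K$ is inner semicompact w.r.t. $\operatorname{dom}K$ at $\bar z\in\operatorname{dom}K$ if for each sequence $\{z_k\}\subset\operatorname{dom}K$ with $z_k\to\bar z$ there is a sequence $\{\lambda_k\}$ possessing a bounded subsequence such that $\lambda_k\in K(z_k)$ for all $k$. (This together with closedness of $\operatorname{gph}K$ makes $\operatorname{dom}K$ closed locally around $\bar z$.) A set-valued mapping $\Upsilon$ is metrically subregular at $(\bar x,\bar y)\in\operatorname{gph}\Upsilon$ if there are $\kappa>0$ and a neighborhood $U$ of $\bar x$ such that $\operatorname{dist}(x,\Upsilon^{-1}(\bar y))\le\kappa\operatorname{dist}(\bar y,\Upsilon(x))$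 for all $x\in U$, where $\Upsilon^{-1}(\bar y)=\{x\mid\bar y\in\Upsilon(x)\}$. An implicit local minimizer of $(\mathrm P)$ is a local minimizer of $(\mathrm P)$ in the usual sense. A feasible point $\bar z$ of $(\mathrm P)$ is an explicit local minimizer of $(\mathrm P)$ if $(\bar z,\bar\lambda)$ is a local minimizer of $(\mathrm Q)$ for each $\bar\lambda\in K(\bar z)$. Stationarity of $\bar z$: - abstractly M-stationary: $-\nabla f(\bar z)\in N_{M\cap\operatorname{dom}K}(\bar z)$; - implicitly M-stationary: $-\nabla f(\bar z)\in N_M(\bar z)+N_{\operatorname{dom}K}(\bar z)$; - explicitly M-stationary w.r.t. $\bar\lambda\in K(\bar z)$: $-\nabla f(\bar z)\in N_M(\bar z)+D^*K(\bar z,\bar\lambda)(0)$; - explicitly M-stationary: the preceding inclusion holds for all $\bar\lambda\in K(\bar z)$. *)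

(* Defs.v *)
From HB Require Import structures.
From mathcomp Require Import all_boot all_order all_algebra.
From mathcomp Require Import all_classical all_reals all_analysis.

Set Implicit Arguments.
Unset Strict Implicit.
Unset Printing Implicit Defensive.
Import Order.TTheory GRing.Theory Num.Theory.
Import numFieldNormedType.Exports.

Local Open Scope classical_set_scope.
Local Open Scope ring_scope.

(* R^n is 'rV[R]_n; a pair in R^n x R^m is the concatenated vector row_mx in
   'rV[R]_(n + m).  The library's norm on 'rV[R]_n is the sup norm: it is only
   used for the topology, and all metric notions below use enorm. *)

Definition dotv (R : realType) (n : nat) (u v : 'rV[R]_n) : R :=
  (u *m v^T) 0 0.

Definition enorm (R : realType) (n : nat) (u : 'rV[R]_n) : R :=
  Num.sqrt (dotv u u).

(* The distance to the empty set is +oo. *)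
Definition eucl_dist (R : realType) (n : nat) (x : 'rV[R]_n) (A : set 'rV[R]_n)
    : \bar R :=
  ereal_inf [set (enorm (x - a))%:E | a in A].

Definition prodv (R : realType) (n m : nat)
    (A : set 'rV[R]_n) (B : set 'rV[R]_m) : set 'rV[R]_(n + m) :=
  [set row_mx a b | a in A & b in B].

Definition sumv (R : realType) (n : nat) (A B : set 'rV[R]_n)
    : set 'rV[R]_n :=
  [set a + b | a in A & b in B].

Definition grad (R : realType) (n : nat) (f : 'rV[R]_n -> R) (z : 'rV[R]_n)
    : 'rV[R]_n :=
  \row_(i < n) 'D_(delta_mx 0 i) (f : 'rV[R]_n -> R^o) z.

Definition continuously_differentiable (R : realType) (n : nat)
    (f : 'rV[R]_n -> R) : Prop :=
  (forall z, differentiable (f : 'rV[R]_n -> R^o) z) /\ continuous (grad f).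

Section SetValuedMaps.
Context (R : realType) (n m : nat) (K : 'rV[R]_n -> set 'rV[R]_m).

Definition gph : set 'rV[R]_(n + m) := [set x | K (lsubmx x) (rsubmx x)].

Definition dom : set 'rV[R]_n := [set z | K z !=set0].

Definition preimage_at (y : 'rV[R]_m) : set 'rV[R]_n := [set x | K x y].

Definition inner_semicompact (zb : 'rV[R]_n) : Prop :=
  dom zb /\
  forall z_ : nat -> 'rV[R]_n,
    (forall k, dom (z_ k)) -> z_ @ \oo --> zb ->
    exists l_ : nat -> 'rV[R]_m,
      (forall k, K (z_ k) (l_ k)) /\
      exists phi : nat -> nat,
        {homo phi : i j / (i < j)%N} /\
        exists C : R, forall k, enorm (l_ (phi k)) <= C.

Definition metrically_subregular (xb : 'rV[R]_n) (yb : 'rV[R]_m) : Prop :=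
  K xb yb /\
  exists2 kappa : R, 0 < kappa &
    \forall x \near xb,
      (eucl_dist x (preimage_at yb) <= kappa%:E * eucl_dist yb (K x))%E.

End SetValuedMaps.

Definition regular_normal_cone (R : realType) (n : nat)
    (Omega : set 'rV[R]_n) (zb : 'rV[R]_n) : set 'rV[R]_n :=
  [set zeta | exists2 r : 'rV[R]_n -> R^o,
    r =o_zb (fun z => enorm (z - zb) : R^o) &
    forall z, Omega z -> dotv zeta (z - zb) <= r z].

Definition limiting_normal_cone (R : realType) (n : nat)
    (Omega : set 'rV[R]_n) (zb : 'rV[R]_n) : set 'rV[R]_n :=
  [set zeta | exists z_ : nat -> 'rV[R]_n, exists zeta_ : nat -> 'rV[R]_n,
    [/\ z_ @ \oo --> zb, zeta_ @ \oo --> zeta, forall k, Omega (z_ k) &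
        forall k, regular_normal_cone Omega (z_ k) (zeta_ k)]].

Definition coderivative (R : realType) (n m : nat)
    (K : 'rV[R]_n -> set 'rV[R]_m) (zb : 'rV[R]_n) (lb : 'rV[R]_m)
    (ys : 'rV[R]_m) : set 'rV[R]_n :=
  [set xs | limiting_normal_cone (gph K) (row_mx zb lb) (row_mx xs (- ys))].

Definition local_minimizer (R : realType) (n : nat) (f : 'rV[R]_n -> R)
    (F : set 'rV[R]_n) (xb : 'rV[R]_n) : Prop :=
  F xb /\ \forall x \near xb, F x -> f xb <= f x.

Section Problem.
Context (R : realType) (n m : nat) (f : 'rV[R]_n -> R) (M : set 'rV[R]_n)
        (K : 'rV[R]_n -> set 'rV[R]_m).

Definition feasibleP : set 'rV[R]_n := M `&` dom K.

Definition feasibleQ : set 'rV[R]_(n + m) :=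
  [set x | M (lsubmx x)] `&` gph K.

Definition implicit_local_minimizer (zb : 'rV[R]_n) : Prop :=
  local_minimizer f feasibleP zb.

Definition local_minimizerQ (zb : 'rV[R]_n) (lb : 'rV[R]_m) : Prop :=
  local_minimizer (fun x : 'rV[R]_(n + m) => f (lsubmx x)) feasibleQ
    (row_mx zb lb).

Definition explicit_local_minimizer (zb : 'rV[R]_n) : Prop :=
  feasibleP zb /\ forall lb, K zb lb -> local_minimizerQ zb lb.

Definition Upsilon_imp (z : 'rV[R]_n) : set 'rV[R]_(n + n) :=
  [set row_mx z z - p | p in prodv M (dom K)].

Definition Upsilon_exp (x : 'rV[R]_(n + m)) : set 'rV[R]_(n + (n + m)) :=
  [set row_mx (lsubmx x) x - p | p in prodv M (gph K)].

Definition abstractly_M_stationary (zb : 'rV[R]_n) : Prop :=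
  limiting_normal_cone (M `&` dom K) zb (- grad f zb).

Definition implicitly_M_stationary (zb : 'rV[R]_n) : Prop :=
  sumv (limiting_normal_cone M zb) (limiting_normal_cone (dom K) zb)
    (- grad f zb).

Definition explicitly_M_stationary_wrt (zb : 'rV[R]_n) (lb : 'rV[R]_m)
    : Prop :=
  sumv (limiting_normal_cone M zb) (coderivative K zb lb 0) (- grad f zb).

Definition explicitly_M_stationary (zb : 'rV[R]_n) : Prop :=
  forall lb, K zb lb -> explicitly_M_stationary_wrt zb lb.

End Problem.

(* Main.v *)
Require Import Defs.
From mathcomp Require Import all_boot all_order all_algebra.
From mathcomp Require Import all_classical all_reals all_analysis.
From mathcomp Require Import ring lra.

Set Implicit Arguments.
Unset Strict Implicit.
Unset Printing Implicit Defensive.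
Import Order.TTheory GRing.Theory Num.Theory.
Import numFieldNormedType.Exports.
Local Open Scope classical_set_scope.
Local Open Scope ring_scope.

(** Abstract M-stationarity is Fermat's rule: at a local minimizer of a
    differentiable function over a set, minus the gradient is a regular normal
    to that set ([fermat_regular_normal]), and regular normals are limiting
    normals.

    Implicit and explicit M-stationarity are instances of one multiplier rule
    ([limiting_multiplier]).  Let xb minimize F locally over the x with x B in
    Omega, where B is a matrix and Omega is locally closed, and suppose that
    x |-> x B - Omega is metrically subregular at (xb, 0).  Then
    - grad F xb = zeta B^T for some limiting normal zeta to Omega at xb B.
    Instead of exact penalization followed by nonsmooth calculus, the proof
    penalizes quadratically.  Subregularity together with the local Lipschitz
    continuity of F makes the problem calm: F xb <= F x + C |x B - y| for x near
    xb and y in Omega near xb B ([calm_penalty]).  For k > 0, a minimizer (x, y)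
    of
      F x + k |x B - y|^2 + |x - xb|^2 + |y - xb B|^2
    over a compact neighbourhood exists, and comparing its value with that of
    (xb, xb B) gives k |x B - y|^2 + |x - xb|^2 + |y - xb B|^2 <= C |x B - y|.
    Hence k |x B - y| <= C: the approximate multipliers 2 k (x B - y) are
    bounded, while (x, y) tends to (xb, xb B) as k grows.  Fermat's rule,
    applied to x and to y separately, says that these multipliers are, up to
    vanishing terms, regular normals to Omega at y which balance grad F x
    ([penalty_point]).  A cluster point is the required zeta.

    For Omega a product M x G and B = (L | 1) the multiplier splits, because
    normals to a product are pairs of normals ([split_multiplier]).  Taking L to
    be the identity and G = dom K, which inner semicompactness makes locally
    closed ([dom_locally_closed]), gives implicit stationarity; taking L to be
    the projection (z, lambda) |-> z and G = gph K gives explicit stationarity.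

    Topological statements use the sup norm of row vectors; it is equivalent to
    the Euclidean norm, so little-o estimates may be written with either. *)

(** * Euclidean inner product and sup norm *)

Section Dot.
Context {R : realType}.
Implicit Types n p : nat.

Lemma dotvE n (u v : 'rV[R]_n) : dotv u v = \sum_i u 0 i * v 0 i.
Proof. by rewrite /dotv mxE; apply: eq_bigr => i _; rewrite mxE. Qed.

Lemma dotvC n (u v : 'rV[R]_n) : dotv u v = dotv v u.
Proof. by rewrite !dotvE; apply: eq_bigr => i _; rewrite mulrC. Qed.

Lemma dotvDl n (u v w : 'rV[R]_n) : dotv (u + v) w = dotv u w + dotv v w.
Proof. by rewrite /dotv mulmxDl mxE. Qed.

Lemma dotvDr n (u v w : 'rV[R]_n) : dotv w (u + v) = dotv w u + dotv w v.
Proof. by rewrite dotvC dotvDl !(dotvC w). Qed.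

Lemma dotvZl n (a : R) (u v : 'rV[R]_n) : dotv (a *: u) v = a * dotv u v.
Proof. by rewrite /dotv -scalemxAl mxE. Qed.

Lemma dotvZr n (a : R) (u v : 'rV[R]_n) : dotv u (a *: v) = a * dotv u v.
Proof. by rewrite dotvC dotvZl dotvC. Qed.

Lemma dotvNl n (u v : 'rV[R]_n) : dotv (- u) v = - dotv u v.
Proof. by rewrite -scaleN1r dotvZl mulN1r. Qed.

Lemma dotv_mulmx n p (B : 'M[R]_(n, p)) (x : 'rV[R]_n) (y : 'rV[R]_p) :
  dotv (x *m B) y = dotv x (y *m B^T).
Proof. by rewrite /dotv trmx_mul trmxK mulmxA. Qed.

Lemma dotv_row_mx n p (a u : 'rV[R]_n) (b v : 'rV[R]_p) :
  dotv (row_mx a b) (row_mx u v) = dotv a u + dotv b v.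
Proof. by rewrite /dotv tr_row_mx mul_row_col mxE. Qed.

Lemma dotvv_ge0 n (u : 'rV[R]_n) : 0 <= dotv u u.
Proof. by rewrite dotvE sumr_ge0// => i _; rewrite -expr2 sqr_ge0. Qed.

Lemma enorm_ge0 n (u : 'rV[R]_n) : 0 <= enorm u.
Proof. exact: sqrtr_ge0. Qed.

Lemma sqr_enorm n (u : 'rV[R]_n) : enorm u ^+ 2 = dotv u u.
Proof. by rewrite sqr_sqrtr ?dotvv_ge0. Qed.

Lemma enormN n (u : 'rV[R]_n) : enorm (- u) = enorm u.
Proof. by rewrite /enorm dotvNl dotvC dotvNl opprK. Qed.

Lemma norm_coord_le n p (A : 'M[R]_(n, p)) i j : `|A i j| <= `|A|.
Proof.
rewrite [leRHS]/Num.norm/= mx_normrE.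
exact: (le_bigmax _ (fun ij => `|A ij.1 ij.2|) (i, j)).
Qed.

Lemma mx_norm_le n p (A : 'M[R]_(n, p)) (c : R) :
  0 <= c -> (forall i j, `|A i j| <= c) -> `|A| <= c.
Proof.
move=> c0 Ac; rewrite [leLHS]/Num.norm/= mx_normrE.
by apply/bigmax_leP; split => // -[i j] _; exact: Ac.
Qed.

Lemma norm_le_enorm n (u : 'rV[R]_n) : `|u| <= enorm u.
Proof.
apply: mx_norm_le => [|i j]; first exact: enorm_ge0.
rewrite (ord1 i) -ler_sqr ?nnegrE ?enorm_ge0//.
rewrite real_normK ?num_real// sqr_enorm dotvE (bigD1 j)//= -expr2 lerDl.
by rewrite sumr_ge0// => k _; rewrite -expr2 sqr_ge0.
Qed.

Lemma norm_dotv_le n (u v : 'rV[R]_n) : `|dotv u v| <= n%:R * (`|u| * `|v|).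
Proof.
rewrite dotvE (le_trans (ler_norm_sum _ _ _))//.
rewrite -[n in n%:R]card_ord -sum1_card natr_sum mulr_suml.
by apply: ler_sum => i _; rewrite mul1r normrM ler_pM// norm_coord_le.
Qed.

Lemma enorm_le_norm n (u : 'rV[R]_n) : enorm u <= n%:R * `|u|.
Proof.
rewrite -(@ger0_norm _ (n%:R * `|u|)) ?mulr_ge0// -sqrtr_sqr ler_wsqrtr//.
rewrite (le_trans (ler_norm _))// (le_trans (norm_dotv_le u u))//.
rewrite exprMn -[`|u| * _]expr2 ler_wpM2r ?sqr_ge0// -natrX ler_nat.
by case: n {u} => // n; rewrite leq_pmull.
Qed.

Lemma norm_mulmx_le n p (B : 'M[R]_(n, p)) (x : 'rV[R]_n) :
  `|x *m B| <= n%:R * `|B| * `|x|.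
Proof.
apply: mx_norm_le => [|i j]; first by rewrite !mulr_ge0.
rewrite mxE (le_trans (ler_norm_sum _ _ _))//.
rewrite -[n in n%:R]card_ord -sum1_card natr_sum -mulrA mulr_suml.
by apply: ler_sum => k _; rewrite mul1r normrM mulrC ler_pM// norm_coord_le.
Qed.

Lemma norm_row_mx_le n p (u : 'rV[R]_n) (v : 'rV[R]_p) :
  `|row_mx u v| <= Num.max `|u| `|v|.
Proof.
apply: mx_norm_le => [|i j]; first by rewrite le_max normr_ge0.
by rewrite mxE; case: splitP => k _; rewrite le_max norm_coord_le ?orbT.
Qed.

Lemma near_norm_le n (x : 'rV[R]_n) (e : R) :
  0 < e -> \forall z \near x, `|x - z| <= e.
Proof. by move=> e0; apply/nbhs_normP; exists e => // z /= /ltW. Qed.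

Lemma near_in_ball n (c x : 'rV[R]_n) (e d : R) :
  `|c - x| <= e -> e < d -> \forall z \near x, `|c - z| <= d.
Proof.
move=> cx ed; apply/nbhs_normP; exists (d - e); first by rewrite /= subr_gt0.
move=> z /= xz; have -> : c - z = (c - x) + (x - z) by rewrite addrA subrK.
by rewrite (le_trans (ler_normD _ _))//; lra.
Qed.

Lemma mulmxr_continuous n p (B : 'M[R]_(n, p)) :
  continuous (fun x : 'rV[R]_n => x *m B).
Proof.
move=> x; apply/(@cvgrPdist_le _ _ _ _ (nbhs_filter x)) => e e0.
pose c := n%:R * `|B| + 1; have c0 : 0 < c by rewrite ltr_wpDl// mulr_ge0.
near=> z; rewrite -mulmxBl (le_trans (norm_mulmx_le _ _))//.
rewrite (@le_trans _ _ (c * `|x - z|))//; first by rewrite ler_wpM2r// lerDl.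
rewrite mulrC -ler_pdivlMr//; near: z.
exact/near_norm_le/divr_gt0.
Unshelve. all: by end_near. Qed.

Lemma dotv_cvg {T : Type} (G : set_system T) {FG : Filter G} n
    (u v : T -> 'rV[R]_n) (a b : 'rV[R]_n) :
  u @ G --> a -> v @ G --> b -> (fun t => dotv (u t) (v t)) @ G --> dotv a b.
Proof.
move=> ua vb.
under eq_fun do rewrite dotvE.
rewrite dotvE; apply: (@cvg_big R^o _ +%R) => [|i _].
  exact: add_continuous.
have cvg_coord (w : T -> 'rV[R]_n) (c : 'rV[R]_n) :
    w @ G --> c -> w t 0 i @[t --> G] --> c 0 i.
  move=> wc; apply: (@cvg_comp _ _ _ w (fun x : 'rV[R]_n => x 0 i) _ (nbhs c)).
    exact: wc.
  exact: coord_continuous.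
by apply: cvgM; exact: cvg_coord.
Qed.

Lemma compact_sup_ball n (x : 'rV[R]_n) (r : R) :
  compact [set y | `|x - y| <= r].
Proof.
apply: bounded_closed_compact; last exact: closed_closed_ball_.
exists (`|x| + r); split; first exact: num_real.
move=> M xM y /= xy; rewrite (le_trans _ (ltW xM))//.
by rewrite -[y](subKr x) (le_trans (ler_normB _ _))// lerD2l.
Qed.

End Dot.

(** * Gradients *)

Section Gradient.
Context {R : realType}.
Implicit Types n p : nat.

(** Differentiability at x with gradient v, in epsilon form: sums become
    immediate, and the Fermat rule needs only one of the two inequalities. *)
Definition has_gradient n (F : 'rV[R]_n -> R) (x v : 'rV[R]_n) : Prop :=
  forall e, 0 < e -> \forall z \near x,
    `|F z - F x - dotv v (z - x)| <= e * `|z - x|.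

Lemma has_gradientD n (F G : 'rV[R]_n -> R) (x u v : 'rV[R]_n) :
  has_gradient F x u -> has_gradient G x v ->
  has_gradient (fun z => F z + G z) x (u + v).
Proof.
move=> Fu Gv e e0; near=> z.
have Fz : `|F z - F x - dotv u (z - x)| <= e / 2 * `|z - x|.
  by near: z; apply: Fu; rewrite divr_gt0.
have Gz : `|G z - G x - dotv v (z - x)| <= e / 2 * `|z - x|.
  by near: z; apply: Gv; rewrite divr_gt0.
rewrite dotvDl; move: (lerD Fz Gz); rewrite -mulrDl -splitr; apply: le_trans.
by rewrite (le_trans _ (ler_normD _ _))// le_eqVlt; apply/orP; left;
  apply/eqP; congr `|_|; ring.
Unshelve. all: by end_near. Qed.

Lemma has_gradient_sqdist n p (B : 'M[R]_(n, p)) (k : R) (x : 'rV[R]_n)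
    (y : 'rV[R]_p) :
  has_gradient (fun z => k * dotv (z *m B - y) (z *m B - y)) x
    ((2 * k) *: ((x *m B - y) *m B^T)).
Proof.
pose c := `|k| * (p%:R * (n%:R * `|B|) ^+ 2) + 1.
have c0 : 0 < c by rewrite ltr_wpDl// !mulr_ge0// sqr_ge0.
(* The expansion of the quadratic is exact, with a quadratic remainder. *)
have rem z : `|k * dotv (z *m B - y) (z *m B - y)
      - k * dotv (x *m B - y) (x *m B - y)
      - dotv ((2 * k) *: ((x *m B - y) *m B^T)) (z - x)| <= c * `|z - x| ^+ 2.
  have [d ->] : exists d, z = x + d by exists (z - x); rewrite addrC subrK.
  have -> : (x + d) *m B - y = (x *m B - y) + d *m B.
    by rewrite mulmxDl -!addrA [d *m B + _]addrC.
  rewrite [x + d]addrC addrK dotvZl dotv_mulmx trmxK.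
  set w := d *m B; move: (x *m B - y) => u.
  rewrite !(dotvDl, dotvDr) (dotvC w u).
  have -> : k * (dotv u u + dotv u w + (dotv u w + dotv w w)) - k * dotv u u
    - 2 * k * dotv u w = k * dotv w w by ring.
  rewrite normrM mulrDl mul1r
    (@le_trans _ _ (`|k| * (p%:R * (n%:R * `|B|) ^+ 2) * `|d| ^+ 2))//;
    last by rewrite lerDl sqr_ge0.
  rewrite -[leRHS]mulrA -[X in _ <= _ * X]mulrA ler_wpM2l//.
  rewrite (le_trans (norm_dotv_le _ _))// ler_wpM2l//.
  by rewrite -exprMn -expr2 ler_sqr ?nnegrE ?mulr_ge0// norm_mulmx_le.
move=> e e0; near=> z; rewrite (le_trans (rem z))// expr2 mulrA ler_wpM2r//.
rewrite mulrC -ler_pdivlMr// -normrN opprB; near: z.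
exact/near_norm_le/divr_gt0.
Unshelve. all: by end_near. Qed.

Lemma has_gradient_sqdist_id n (k : R) (c x : 'rV[R]_n) :
  has_gradient (fun z => k * dotv (z - c) (z - c)) x ((2 * k) *: (x - c)).
Proof.
have := @has_gradient_sqdist n n 1%:M k x c.
rewrite trmx1 !mulmx1; under eq_fun do rewrite mulmx1; exact.
Qed.

Lemma dotv_grad n (f : 'rV[R]_n -> R) (z h : 'rV[R]_n) :
  differentiable (f : 'rV[R]_n -> R^o) z ->
  dotv (grad f z) h = 'd (f : 'rV[R]_n -> R^o) z h.
Proof.
move=> df; rewrite [in RHS](row_sum_delta h) linear_sum dotvE.
by apply: eq_bigr => i _; rewrite linearZ/= mxE deriveE// mulrC.
Qed.

Lemma differentiable_has_gradient n (f : 'rV[R]_n -> R) (z : 'rV[R]_n) :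
  differentiable (f : 'rV[R]_n -> R^o) z -> has_gradient f z (grad f z).
Proof.
move=> df e e0.
have := diff_locally df.
move=> /eqaddoP/(_ e e0)/nbhs_normP[d /= d0 hd].
apply/nbhs_normP; exists d => // w /= zw.
have := hd (w - z); rewrite /= sub0r normrN distrC => /(_ zw).
by rewrite !fctE/= /shift/= subrK dotv_grad// opprD addrA.
Qed.

Lemma grad_mulmx n p (L : 'M[R]_(n, p)) (f : 'rV[R]_p -> R) x :
  differentiable (f : 'rV[R]_p -> R^o) (x *m L) ->
  differentiable ((fun x => f (x *m L)) : 'rV[R]_n -> R^o) x /\
  grad (fun x => f (x *m L)) x = grad f (x *m L) *m L^T.
Proof.
move=> df.
have dL : differentiable (mulmxr L : 'rV[R]_n -> 'rV[R]_p) x.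
  by apply: linear_differentiable; exact: mulmxr_continuous.
have dfL : differentiable ((fun x => f (x *m L)) : 'rV[R]_n -> R^o) x.
  exact: differentiable_comp dL df.
split => //; apply/rowP => i; rewrite mxE deriveE//.
have -> : 'd ((fun x => f (x *m L)) : 'rV[R]_n -> R^o) x =
    'd (f : 'rV[R]_p -> R^o) (x *m L) \o
    'd (mulmxr L : 'rV[R]_n -> 'rV[R]_p) x :> (_ -> _).
  exact: diff_comp.
rewrite diff_lin/=; last exact: mulmxr_continuous.
rewrite -dotv_grad// dotvC dotv_mulmx dotvE (bigD1 i)//= mxE !eqxx mul1r.
rewrite big1 ?addr0// => j ji.
by rewrite mxE (negbTE ji) mul0r.
Qed.

Lemma C1_mulmx n p (L : 'M[R]_(n, p)) (f : 'rV[R]_p -> R) :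
  continuously_differentiable f ->
  continuously_differentiable (fun x => f (x *m L)).
Proof.
move=> [df cf]; split=> [x|]; first by have [] := grad_mulmx (df (x *m L)).
have -> : grad (fun x => f (x *m L)) = fun x => grad f (x *m L) *m L^T.
  by apply/funext => x; have [] := grad_mulmx (df (x *m L)).
move=> x.
have c1 := @mulmxr_continuous R n p L x.
have c2 := cvg_comp _ _ c1 (cf (x *m L)).
exact: cvg_comp _ _ c2 (@mulmxr_continuous R p n L^T _).
Qed.

(** The gradient is bounded on a ball, and a ball is convex, so the mean value
    theorem along segments gives the Lipschitz bound. *)
Lemma C1_lipschitz_near n (f : 'rV[R]_n -> R) (x : 'rV[R]_n) :
  continuously_differentiable f ->
  exists2 l, 0 <= l & exists2 d, 0 < d & forall z w,
    `|x - z| < d -> `|x - w| < d -> `|f z - f w| <= l * `|z - w|.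
Proof.
move=> [df cf].
have [d d0 bnd] : exists2 d, 0 < d &
    forall z, `|x - z| < d -> `|grad f z| <= `|grad f x| + 1.
  have : \forall z \near x, `|grad f x - grad f z| <= 1.
    by have /cvgrPdist_le := cf x; apply.
  move=> /nbhs_normP[d /= d0 xd]; exists d => // z /xd/= xz.
  by rewrite -[grad f z](subKr (grad f x)) (le_trans (ler_normB _ _))// lerD2l.
exists (n%:R * (`|grad f x| + 1)); first by rewrite mulr_ge0// addr_ge0.
exists d => // z w xz xw.
pose v := z - w; pose phi (t : R) : R^o := f (w + t *: v).
have dphi (t : R) : is_derive t (1 : R) phi (dotv (grad f (w + t *: v)) v).
  have E : (fun h : R => h^-1 *: ((phi \o shift t) (h *: (1 : R)) - phi t)) =
    (fun h => h^-1 *: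
      (((f : _ -> R^o) \o shift (w + t *: v)) (h *: v) - f (w + t *: v))).
    apply/funext => h; rewrite /phi/= /shift/=; congr (_ *: (f _ - _)).
    by rewrite scalerDl addrCA [h *: 1]mulr1.
  split; first by rewrite /derivable E; exact: diff_derivable.
  rewrite /derive E -[LHS]/('D_v (f : _ -> R^o) (w + t *: v)).
  by rewrite deriveE// dotv_grad.
have cphi : {within `[0, 1], continuous phi}.
  apply: continuous_subspaceT => t; apply: differentiable_continuous.
  by apply/derivable1_diffP; exact: ex_derive.
have [t t01] := MVT_segment ler01 (fun t _ => dphi t) cphi.
rewrite /phi scale1r scale0r addr0 subr0 mulr1 /v [w + _]addrC subrK => ->.
rewrite (le_trans (norm_dotv_le _ _))// -mulrA ler_wpM2l// ler_wpM2r// bnd//.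
have -> : x - (w + t *: (z - w)) = (1 - t) *: (x - w) + t *: (x - z).
  by apply/rowP => i; rewrite !mxE; ring.
move: t01; rewrite in_itv/= => /andP[t0 t1].
rewrite (le_lt_trans (ler_normD _ _))// !normrZ (ger0_norm t0).
rewrite ger0_norm ?subr_ge0//.
have [->|tn0] := eqVneq t 0; first by rewrite subr0 mul1r mul0r addr0.
have : t * `|x - z| < t * d by rewrite ltr_pM2l// lt_def tn0.
have : (1 - t) * `|x - w| <= (1 - t) * d by rewrite ler_wpM2l ?subr_ge0// ltW.
lra.
Qed.

End Gradient.

(** * Normal cones and locally closed sets *)

Section Cones.
Context {R : realType}.
Implicit Types n p : nat.

Lemma regular_normalP n (Omega : set 'rV[R]_n) (y zeta : 'rV[R]_n) :
  regular_normal_cone Omega y zeta <->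
  forall e, 0 < e -> \forall z \near y,
    Omega z -> dotv zeta (z - y) <= e * `|z - y|.
Proof.
split=> [[r /eqoP ro rOmega] e e0|H].
  have n0 : 0 < n%:R + 1 :> R by rewrite ltr_wpDl.
  have := ro (e / (n%:R + 1)) (divr_gt0 e0 n0).
  apply: filterS => z rz Oz; rewrite (le_trans (rOmega _ Oz))//.
  rewrite (le_trans (ler_norm _))// (le_trans rz)//.
  rewrite ger0_norm ?enorm_ge0// -mulrA ler_wpM2l ?(ltW e0)//.
  rewrite mulrC ler_pdivrMr// (le_trans (enorm_le_norm _))// mulrC.
  by rewrite ler_wpM2l// lerDl.
(* The least admissible remainder: the positive part, cut off outside Omega. *)
pose r z : R^o := if z \in Omega then Num.max 0 (dotv zeta (z - y)) else 0.
exists r => [|z Oz]; last by rewrite /r mem_set// le_max lexx orbT.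
apply/eqoP => e e0; have := H e e0; apply: filterS => z Hz.
rewrite /r; case: ifPn => [/set_mem Oz|_]; last first.
  by rewrite normr0 mulr_ge0// ltW.
rewrite ger0_norm ?le_max ?lexx// ge_max mulr_ge0 ?(ltW e0)//=.
rewrite (le_trans (Hz Oz))// ler_wpM2l ?(ltW e0)// ger0_norm ?enorm_ge0//.
exact: norm_le_enorm.
Qed.

(** This turns the Fermat rule over the whole space into the vanishing of the
    gradient. *)
Lemma regular_normal_setT n (y zeta : 'rV[R]_n) :
  regular_normal_cone setT y zeta -> zeta = 0.
Proof.
move=> /regular_normalP H; apply/eqP; rewrite -normr_eq0.
apply/negPn/negP => z0.
have {}z0 : 0 < `|zeta| by rewrite lt_def z0 normr_ge0.
(* Moving from y by a small multiple of zeta itself contradicts the bound with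
   the constant |zeta| / 2. *)
have h0 : 0 < `|zeta| / 2 by rewrite divr_gt0.
have /nbhs_normP[d /= d0 Hd] := H _ h0.
pose t := d / 2 / `|zeta|.
have t0 : 0 < t by rewrite !divr_gt0.
have /= := Hd (y + t *: zeta).
rewrite opprD addNKr normrN normrZ (gtr0_norm t0) divfK ?gt_eqF// => /(_ _ I).
rewrite ltr_pdivrMr// ltr_pMr// ltr1n => /(_ isT).
rewrite addrAC subrr add0r normrZ (gtr0_norm t0) dotvZr mulrCA ler_pM2l//.
apply/negP; rewrite -ltNge -sqr_enorm.
have ze := norm_le_enorm zeta.
have : `|zeta| ^+ 2 <= enorm zeta ^+ 2 by rewrite ler_sqr ?nnegrE ?enorm_ge0.
by apply: lt_le_trans; nra.
Qed.

(** Optimality says that F does not decrease along Omega, and the first-order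
    expansion of F turns this into the inequality that defines a regular
    normal. *)
Lemma fermat_regular_normal n (F : 'rV[R]_n -> R) (Omega : set 'rV[R]_n)
    (y v : 'rV[R]_n) :
  has_gradient F y v -> local_minimizer F Omega y ->
  regular_normal_cone Omega y (- v).
Proof.
move=> Fv [_ Fmin]; apply/regular_normalP => e e0.
apply: filterS2 (Fv e e0) Fmin => z Hz Fz Oz; have := Fz Oz.
by move: Hz; rewrite ler_norml dotvNl => /andP[_]; lra.
Qed.

Lemma regular_limiting_normal n (Omega : set 'rV[R]_n) (y zeta : 'rV[R]_n) :
  Omega y -> regular_normal_cone Omega y zeta ->
  limiting_normal_cone Omega y zeta.
Proof.
by move=> Oy Nz; exists (fun=> y), (fun=> zeta); split => //; exact: cvg_cst.
Qed.

Lemma prodv_row_mx n p (M : set 'rV[R]_n) (G : set 'rV[R]_p) a b :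
  prodv M G (row_mx a b) <-> M a /\ G b.
Proof.
split=> [[a' Ma [b' Gb /eq_row_mx[<- <-]]]//|[Ma Gb]].
by exists a => //; exists b.
Qed.

Lemma prodvP n p (M : set 'rV[R]_n) (G : set 'rV[R]_p) y :
  prodv M G y <-> M (lsubmx y) /\ G (rsubmx y).
Proof. by rewrite -[X in prodv _ _ X]hsubmxK; exact: prodv_row_mx. Qed.

(** Moving one component and freezing the other stays in the product, so each
    half of a normal is tested against its own factor. *)
Lemma regular_normal_prodv n p (M : set 'rV[R]_n) (G : set 'rV[R]_p)
    (y zeta : 'rV[R]_(n + p)) :
  prodv M G y -> regular_normal_cone (prodv M G) y zeta ->
  regular_normal_cone M (lsubmx y) (lsubmx zeta) /\
  regular_normal_cone G (rsubmx y) (rsubmx zeta).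
Proof.
rewrite -[y]hsubmxK -[zeta]hsubmxK !row_mxKl !row_mxKr.
move: (lsubmx y) (rsubmx y) (lsubmx zeta) (rsubmx zeta) => a b u v.
move=> /prodv_row_mx[Ma Gb] /regular_normalP H; split.
- apply/regular_normalP => e e0; have /nbhs_normP[d /= d0 Hd] := H e e0.
  apply/nbhs_normP; exists d => // z /= az Mz.
  have N (w : 'rV[R]_n) : `|row_mx w (0 : 'rV[R]_p)| <= `|w|.
    by rewrite (le_trans (norm_row_mx_le _ _))// ge_max lexx normr0 normr_ge0.
  have := Hd (row_mx z b).
  rewrite /= !opp_row_mx !add_row_mx !subrr dotv_row_mx.
  rewrite (_ : dotv v 0 = 0) ?addr0; last by rewrite /dotv trmx0 mulmx0 mxE.
  move=> /(_ (le_lt_trans (N _) az)).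
  move=> /(_ ((prodv_row_mx _ _ _ _).2 (conj Mz Gb))).
  by move=> /le_trans; apply; rewrite ler_wpM2l ?(ltW e0).
- apply/regular_normalP => e e0; have /nbhs_normP[d /= d0 Hd] := H e e0.
  apply/nbhs_normP; exists d => // z /= bz Gz.
  have N (w : 'rV[R]_p) : `|row_mx (0 : 'rV[R]_n) w| <= `|w|.
    by rewrite (le_trans (norm_row_mx_le _ _))// ge_max lexx normr0 normr_ge0.
  have := Hd (row_mx a z).
  rewrite /= !opp_row_mx !add_row_mx !subrr dotv_row_mx.
  rewrite (_ : dotv u 0 = 0) ?add0r; last by rewrite /dotv trmx0 mulmx0 mxE.
  move=> /(_ (le_lt_trans (N _) bz)).
  move=> /(_ ((prodv_row_mx _ _ _ _).2 (conj Ma Gz))).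
  by move=> /le_trans; apply; rewrite ler_wpM2l ?(ltW e0).
Qed.

Lemma limiting_normal_prodv n p (M : set 'rV[R]_n) (G : set 'rV[R]_p)
    (y zeta : 'rV[R]_(n + p)) :
  limiting_normal_cone (prodv M G) y zeta ->
  limiting_normal_cone M (lsubmx y) (lsubmx zeta) /\
  limiting_normal_cone G (rsubmx y) (rsubmx zeta).
Proof.
move=> [y_ [z_ [yy zz Oy Nz]]]; split.
- exists (lsubmx \o y_), (lsubmx \o z_); split => [||k|k].
  + exact: cvg_comp yy (@continuous_lsubmx _ _ _ _ _).
  + exact: cvg_comp zz (@continuous_lsubmx _ _ _ _ _).
  + by have /prodvP[] := Oy k.
  + by have [] := regular_normal_prodv (Oy k) (Nz k).
- exists (rsubmx \o y_), (rsubmx \o z_); split => [||k|k].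
  + exact: cvg_comp yy (@continuous_rsubmx _ _ _ _ _).
  + exact: cvg_comp zz (@continuous_rsubmx _ _ _ _ _).
  + by have /prodvP[] := Oy k.
  + by have [] := regular_normal_prodv (Oy k) (Nz k).
Qed.

Definition locally_closed n (Omega : set 'rV[R]_n) (y : 'rV[R]_n) : Prop :=
  exists2 V, nbhs y V & closed (Omega `&` V).

Lemma closed_locally_closed n (Omega : set 'rV[R]_n) (y : 'rV[R]_n) :
  closed Omega -> locally_closed Omega y.
Proof. by move=> cO; exists setT; [exact: filterT|rewrite setIT]. Qed.

Lemma locally_closed_prodv n p (M : set 'rV[R]_n) (G : set 'rV[R]_p) a b :
  locally_closed M a -> locally_closed G b ->
  locally_closed (prodv M G) (row_mx a b).
Proof.
move=> [V aV cV] [W bW cW].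
exists ((lsubmx @^-1` V) `&` (rsubmx @^-1` W)).
  apply: filterI; [apply: continuous_lsubmx|apply: continuous_rsubmx];
  by rewrite ?row_mxKl ?row_mxKr.
have -> : prodv M G `&` (lsubmx @^-1` V `&` rsubmx @^-1` W) =
    (lsubmx @^-1` (M `&` V)) `&` (rsubmx @^-1` (G `&` W)).
  by apply/seteqP; split => y /=; rewrite prodvP; tauto.
by apply: closedI; apply: closed_comp => // y _;
  [exact: continuous_lsubmx|exact: continuous_rsubmx].
Qed.

Lemma locally_closed_compact_ball n (Omega : set 'rV[R]_n) (y : 'rV[R]_n) :
  locally_closed Omega y ->
  exists2 d0, 0 < d0 & forall d, d < d0 ->
    compact (Omega `&` [set z | `|y - z| <= d]).
Proof.
move=> [V /nbhs_normP[d0 /= d00 dV] cV]; exists d0 => // d dd0.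
have -> : Omega `&` [set z | `|y - z| <= d] =
    [set z | `|y - z| <= d] `&` (Omega `&` V).
  apply/seteqP; split => z /=; last tauto.
  move=> [Oz yz]; split=> //; split => //; apply: dV => /=.
  exact: le_lt_trans yz dd0.
apply: compact_closedI => //; exact: compact_sup_ball.
Qed.

End Cones.

(** * Multiplier rule under metric subregularity *)

Section Multiplier.
Context {R : realType}.
Implicit Types n p : nat.

(** Calmness.  Subregularity provides a feasible w whose distance to x is at
    most a multiple of |x B - y|; optimality of xb at w and the Lipschitz
    continuity of F between w and x give the estimate. *)
Lemma calm_penalty n p (F : 'rV[R]_n -> R) (B : 'M[R]_(n, p))
    (Omega : set 'rV[R]_p) (xb : 'rV[R]_n) :
  continuously_differentiable F ->
  local_minimizer F [set x | Omega (x *m B)] xb ->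
  metrically_subregular (fun x => [set x *m B - y | y in Omega]) xb 0 ->
  exists2 C, 0 <= C & exists2 d, 0 < d & forall x y,
    `|xb - x| <= d -> `|xb *m B - y| <= d -> Omega y ->
    F xb <= F x + C * enorm (x *m B - y).
Proof.
move=> F1 [Oxb /nbhs_normP[d1 /= d10 Fmin]].
move=> [_ [kappa k0 /nbhs_normP[d2 /= d20 sub]]].
have [l l0 [d3 d30 Flip]] := C1_lipschitz_near xb F1.
pose dm := Num.min d1 d3; have dm0 : 0 < dm by rewrite lt_min d10.
(* The residual |x B - y| is at most c times the radius, and a feasible point
   lies within (kappa + 1) residuals of x; the radius dm / q keeps it inside
   the ball of radius dm, where optimality and the Lipschitz bound hold. *)
pose c := p%:R * (n%:R * `|B| + 1).
have c0 : 0 <= c by rewrite mulr_ge0// addr_ge0// mulr_ge0.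
pose q := 2 + (kappa + 1) * c.
have q1 : 1 < q.
  by rewrite -[1]addr0 ltr_leD ?mulr_ge0 ?addr_ge0 ?(ltW k0)// ltr1n.
have q0 : 0 < q by lra.
exists (l * (kappa + 1)); first by rewrite mulr_ge0// addr_ge0// ltW.
exists (Num.min (dm / q) (d2 / 2)); first by rewrite lt_min !divr_gt0.
move=> x y; rewrite !le_min => /andP[xd1 xd2] /andP[yd1 yd2] Oy.
set rho := enorm (x *m B - y).
have rho0 : 0 <= rho by exact: enorm_ge0.
have rhoc : rho <= c * (dm / q).
  rewrite /rho (le_trans (enorm_le_norm _))// /c -mulrA ler_wpM2l//.
  have -> : x *m B - y = (xb *m B - y) - (xb - x) *m B.
    by rewrite mulmxBl opprB addrCA [_ - y + _]addrC addrA addrA subrK.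
  rewrite (le_trans (ler_normB _ _))// mulrDl mul1r addrC lerD//.
  by rewrite (le_trans (norm_mulmx_le _ _))// ler_wpM2l ?mulr_ge0.
(* The distance is an infimum that need not be attained: kappa + 1 instead of
   kappa leaves room for a point w when the residual is positive, and w = x does
   when it vanishes. *)
have [w Ow xw] : exists2 w, Omega (w *m B) & enorm (x - w) <= (kappa + 1) * rho.
  have [rz|rn] := eqVneq rho 0.
    exists x; last by rewrite subrr rz mulr0 /enorm /dotv mul0mx mxE sqrtr0.
    have : `|x *m B - y| <= 0 by rewrite -rz norm_le_enorm.
    by rewrite normr_le0 subr_eq0 => /eqP ->.
  have : (eucl_dist x
      (preimage_at (fun x => [set (x *m B - y)%R | y in Omega]) 0) <
          ((kappa + 1) * rho)%:E)%E.
    have xd : `|xb - x| < d2 by lra.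
    rewrite (le_lt_trans (sub x xd))//.
    apply: (@le_lt_trans _ _ (kappa%:E * rho%:E)%E).
      rewrite lee_pmul2l ?lte_fin//; apply: ereal_inf_lbound.
      exists (x *m B - y); first by exists y.
      by rewrite sub0r enormN.
    by rewrite -EFinM lte_fin ltr_pM2r ?ltrDl// lt_def rn.
  move=> /ereal_inf_lt[_ [w [y' Oy' /eqP wy] <-]]; rewrite lte_fin => /ltW xw.
  move: wy; rewrite subr_eq0 => /eqP wy.
  by exists w => //; rewrite wy.
have xbw : `|xb - w| < dm.
  have -> : xb - w = (xb - x) + (x - w) by rewrite addrA subrK.
  rewrite (le_lt_trans (ler_normD _ _))//.
  have xw' : `|x - w| <= (kappa + 1) * c * (dm / q).
    rewrite (le_trans (norm_le_enorm _))// (le_trans xw)// -mulrA ler_wpM2l//.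
    by rewrite addr_ge0// ltW.
  apply: (le_lt_trans (lerD xd1 xw')).
  rewrite -[X in X + _]mul1r -mulrDl mulrCA gtr_pMr// ltr_pdivrMr// mul1r.
  by rewrite /q ltrD2r ltr1n.
move: xbw; rewrite lt_min => /andP[w1 w3].
have x3 : `|xb - x| < d3.
  rewrite (le_lt_trans xd1)// (@lt_le_trans _ _ dm)//.
    by rewrite gtr_pMr// invf_lt1.
  by rewrite ge_min lexx orbT.
rewrite (le_trans (Fmin w w1 Ow))//.
have := Flip x w x3 w3; rewrite distrC ler_norml => /andP[_].
rewrite lerBlDl => /le_trans; apply.
by rewrite lerD2l -mulrA ler_wpM2l// (le_trans (norm_le_enorm _)).
Qed.

(** Approximate multipliers from quadratic penalization; zeta is
    2 k (x B - y) - 2 (y - xb B) at a minimizer (x, y) of the penalized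
    function.  The bound on zeta, uniform in e, is where calmness matters. *)
Lemma penalty_point n p (F : 'rV[R]_n -> R) (B : 'M[R]_(n, p))
    (Omega : set 'rV[R]_p) (xb : 'rV[R]_n) (C d : R) :
  continuously_differentiable F -> locally_closed Omega (xb *m B) ->
  Omega (xb *m B) -> 0 <= C -> 0 < d ->
  (forall x y, `|xb - x| <= d -> `|xb *m B - y| <= d -> Omega y ->
    F xb <= F x + C * enorm (x *m B - y)) ->
  forall e, 0 < e -> exists x y zeta,
    [/\ `|xb - x| <= e, `|xb *m B - y| <= e, `|zeta| <= 2 * C + 2 * e,
        Omega y /\ regular_normal_cone Omega y zeta &
        grad F x + 2 *: (x - xb) + (zeta + 2 *: (y - xb *m B)) *m B^T = 0].
Proof.
move=> [dF _] lcO Oxb C0 d0 calm e e0; set yb := xb *m B.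
have [d' d'0 cO] := locally_closed_compact_ball lcO.
pose r := Num.min (d' / 2) d.
have r0 : 0 < r by rewrite lt_min d0 divr_gt0.
have rd : r <= d by rewrite ge_min lexx orbT.
pose s := Num.min e (r / 2).
have s0 : 0 < s by rewrite lt_min e0 divr_gt0.
have se : s <= e by rewrite ge_min lexx.
have sr : s < r.
  by rewrite (@le_lt_trans _ _ (r / 2))//; [rewrite ge_min lexx orbT|lra].
(* With rho = |x B - y|, minimality gives |x - xb|^2 <= C rho <= C^2 / k, and
   likewise for y; this k makes the bound at most s^2. *)
pose k := C ^+ 2 / s ^+ 2 + 1.
have k0 : 0 < k by rewrite ltr_wpDl// divr_ge0 ?sqr_ge0.
have ks : C ^+ 2 <= k * s ^+ 2.
  by rewrite mulrDl divfK ?gt_eqF ?exprn_gt0// lerDl mul1r sqr_ge0.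
pose S := [set x | `|xb - x| <= r] `*` (Omega `&` [set z | `|yb - z| <= r]).
have cS : compact S.
  apply: compact_setX; first exact: compact_sup_ball.
  apply: cO; rewrite (@le_lt_trans _ _ (d' / 2))//.
    by rewrite ge_min lexx.
  lra.
(* The factors 1 give every quadratic term the shape k |z - c|^2. *)
pose Phi (t : 'rV[R]_n * 'rV[R]_p) : R := F t.1 +
  k * dotv (t.1 *m B - t.2) (t.1 *m B - t.2) +
  1 * dotv (t.1 - xb) (t.1 - xb) + 1 * dotv (t.2 - yb) (t.2 - yb).
have Sb : S (xb, yb) by split; [|split] => //=; rewrite subrr normr0 ltW.
have cPhi : continuous Phi.
  move=> t; rewrite /Phi.
  have c1 : fst @ t --> t.1 by exact: cvg_fst.
  have c2 : snd @ t --> t.2 by exact: cvg_snd.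
  have cB : (fun t : 'rV[R]_n * 'rV[R]_p => t.1 *m B - t.2) @ t -->
      t.1 *m B - t.2.
    apply: cvgB => //; exact: cvg_comp c1 (@mulmxr_continuous R n p B _).
  have cx : (fun t : 'rV[R]_n * 'rV[R]_p => t.1 - xb) @ t --> t.1 - xb.
    by apply: cvgB => //; exact: cvg_cst.
  have cy : (fun t : 'rV[R]_n * 'rV[R]_p => t.2 - yb) @ t --> t.2 - yb.
    by apply: cvgB => //; exact: cvg_cst.
  have cF := cvg_comp _ _ c1 (differentiable_continuous (dF t.1)).
  by apply: cvgD; [apply: cvgD; [apply: cvgD => //|]|];
    apply: cvgM; (try exact: cvg_cst); exact: dotv_cvg.
have [|[x y] /set_mem[/= xr [Oy yr]] mint] :=
  compact_EVT_min _ cS (continuous_subspaceT cPhi); first by exists (xb, yb).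
have minP a b : `|xb - a| <= r -> `|yb - b| <= r -> Omega b ->
    Phi (x, y) <= Phi (a, b).
  by move=> ar br Ob; apply: mint; rewrite inE.
have dotv00 q : dotv (0 : 'rV[R]_q) 0 = 0 by rewrite /dotv mul0mx mxE.
have := minP xb yb; rewrite subrr normr0 ltW// subrr normr0 ltW//.
move=> /(_ isT isT Oxb); rewrite /Phi/= !subrr !dotv00.
rewrite !mulr0 !addr0 !mul1r -!sqr_enorm.
have := calm x y (le_trans xr rd) (le_trans yr rd) Oy.
have := enorm_ge0 (x *m B - y).
have := enorm_ge0 (x - xb); have := enorm_ge0 (y - yb).
set ry := enorm (y - yb); set rx := enorm (x - xb).
set rho := enorm (x *m B - y).
move=> ry0 rx0 rho0 H1 H2.
have krho : k * rho <= C.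
  have [->|rn] := eqVneq rho 0; first by rewrite mulr0.
  have rp : 0 < rho by rewrite lt_def rn.
  rewrite -(ler_pM2r rp); have := sqr_ge0 rx; have := sqr_ge0 ry; nra.
have Crho : C * rho <= s ^+ 2.
  rewrite -(ler_pM2l k0) (le_trans _ ks)// mulrCA expr2 ler_wpM2l//.
have rxs : rx <= s.
  rewrite -ler_sqr ?nnegrE ?(ltW s0)// (le_trans _ Crho)//.
  have := sqr_ge0 ry.
  have : 0 <= k * rho ^+ 2 by rewrite mulr_ge0 ?sqr_ge0 ?ltW.
  lra.
have rys : ry <= s.
  rewrite -ler_sqr ?nnegrE ?(ltW s0)// (le_trans _ Crho)//.
  have := sqr_ge0 rx.
  have : 0 <= k * rho ^+ 2 by rewrite mulr_ge0 ?sqr_ge0 ?ltW.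
  lra.
have xs : `|xb - x| <= s by rewrite distrC (le_trans (norm_le_enorm _)).
have ys : `|yb - y| <= s by rewrite distrC (le_trans (norm_le_enorm _)).
have gx : grad F x +
    ((2 * k) *: ((x *m B - y) *m B^T) + (2 * 1) *: (x - xb)) = 0.
  rewrite -[LHS]opprK; apply/eqP; rewrite oppr_eq0; apply/eqP.
  apply: (@regular_normal_setT _ _ x); apply: fermat_regular_normal.
    apply: has_gradientD (differentiable_has_gradient (dF x)) _.
    apply: has_gradientD (has_gradient_sqdist_id 1 xb x).
    exact: has_gradient_sqdist.
  split => //; apply: filterS (near_in_ball xs sr) => z zr _.
  by have := minP z y zr yr Oy; rewrite /Phi/=; lra.
have gy : regular_normal_cone Omega y
    (- ((2 * k) *: (y - x *m B) + (2 * 1) *: (y - yb))).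
  apply: fermat_regular_normal.
    apply: has_gradientD (has_gradient_sqdist_id 1 yb y).
    exact: has_gradient_sqdist_id.
  split => //; apply: filterS (near_in_ball ys sr) => z zr Oz.
  have := minP x z xr zr Oz; rewrite /Phi/=.
  have sw (a b : 'rV[R]_p) : dotv (a - b) (a - b) = dotv (b - a) (b - a).
    by rewrite -opprB dotvNl dotvC dotvNl opprK.
  rewrite (sw y) (sw z); lra.
exists x, y, (- ((2 * k) *: (y - x *m B) + (2 * 1) *: (y - yb))).
split => //; [exact: le_trans se|exact: le_trans se| |].
- rewrite normrN (le_trans (ler_normD _ _))// !normrZ (gtr0_norm k0) normr1.
  rewrite gtr0_norm//.
  rewrite mulr1 lerD//; last by rewrite ler_pM2l// distrC (le_trans ys).
  rewrite -mulrA ler_pM2l// (le_trans _ krho)// ler_pM2l// distrC.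
  exact: norm_le_enorm.
- move: gx; rewrite mulr1 opprD addrNK -scalerN opprB -scalemxAl => <-.
  by rewrite addrAC addrA.
Qed.

(** Each point of the sequence satisfies the balance equation exactly, so it
    passes to the limit by continuity of the gradient; the multipliers have a
    cluster point because they are bounded. *)
Theorem limiting_multiplier n p (F : 'rV[R]_n -> R) (B : 'M[R]_(n, p))
    (Omega : set 'rV[R]_p) (xb : 'rV[R]_n) :
  continuously_differentiable F -> locally_closed Omega (xb *m B) ->
  local_minimizer F [set x | Omega (x *m B)] xb ->
  metrically_subregular (fun x => [set x *m B - y | y in Omega]) xb 0 ->
  exists2 zeta, limiting_normal_cone Omega (xb *m B) zeta &
    - grad F xb = zeta *m B^T.
Proof.
move=> F1 lcO Fmin sub.
have [C C0 [d d0 calm]] := calm_penalty F1 Fmin sub.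
have /choice[t ht] : forall k : nat, exists t : 'rV[R]_n * 'rV[R]_p * 'rV[R]_p,
    let e := k.+1%:R^-1 in
    [/\ `|xb - t.1.1| <= e, `|xb *m B - t.1.2| <= e, `|t.2| <= 2 * C + 2 * e,
        Omega t.1.2 /\ regular_normal_cone Omega t.1.2 t.2 &
        grad F t.1.1 + 2 *: (t.1.1 - xb) +
          (t.2 + 2 *: (t.1.2 - xb *m B)) *m B^T = 0].
  move=> k; have e0 : 0 < k.+1%:R^-1 :> R by rewrite invr_gt0.
  have [x [y [zeta H]]] := penalty_point F1 lcO Fmin.1 C0 d0 calm e0.
  by exists (x, y, zeta).
have inv1 k : k.+1%:R^-1 <= 1 :> R by rewrite invf_le1// ler1n.
have [zeta [_ zcl]] : [set z | `|0 - z| <= 2 * C + 2] `&`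
    cluster ((fun k => (t k).2) @ \oo) !=set0.
  apply: (@compact_sup_ball R p 0 (2 * C + 2) ((fun k => (t k).2) @ \oo) _).
  exists 0%N => // k _ /=; have [_ _ tk _ _] := ht k.
  by rewrite sub0r normrN (le_trans tk)// lerD2l ler_piMr.
(* Indices phi k >= k suffice, since the other error bounds decrease in the
   index. *)
have /choice[phi phiP] : forall k : nat, exists j,
    (k <= j)%N /\ `|zeta - (t j).2| <= k.+1%:R^-1.
  move=> k; have [] := zcl [set (t j).2 | j in [set j | (k <= j)%N]]
     [set z | `|zeta - z| <= k.+1%:R^-1].
  - by exists k => // j /= kj; exists j.
  - by apply: near_norm_le; rewrite invr_gt0.
  - by move=> _ [[j kj <-] zj]; exists j.
have cvg_inv m (u : nat -> 'rV[R]_m) (a : 'rV[R]_m) :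
    (forall k, `|a - u k| <= k.+1%:R^-1) -> u @ \oo --> a.
  move=> ua; apply/cvgrPdist_le => e e0; near=> k.
  rewrite (le_trans (ua k))//; apply: ltW; near: k.
  exact: near_infty_natSinv_lt (PosNum e0).
have phi_inv k : (phi k).+1%:R^-1 <= k.+1%:R^-1 :> R.
  by rewrite lef_pV2 ?posrE// ler_nat ltnS; have [] := phiP k.
have xcvg : (fun k => (t (phi k)).1.1) @ \oo --> xb.
  by apply: cvg_inv => k; have [H _ _ _ _] := ht (phi k); exact: le_trans H _.
have ycvg : (fun k => (t (phi k)).1.2) @ \oo --> xb *m B.
  by apply: cvg_inv => k; have [_ H _ _ _] := ht (phi k); exact: le_trans H _.
have zcvg : (fun k => (t (phi k)).2) @ \oo --> zeta.
  by apply: cvg_inv => k; have [] := phiP k.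
exists zeta.
  exists (fun k => (t (phi k)).1.2), (fun k => (t (phi k)).2).
  by split=> // k; have [_ _ _ []] := ht (phi k).
have cvg_shift m (u : nat -> 'rV[R]_m) (a : 'rV[R]_m) :
    u @ \oo --> a -> (fun k => 2 *: (u k - a)) @ \oo --> (2 : R) *: (a - a).
  move=> ua; apply: cvgZ; first exact: cvg_cst.
  by apply: cvgB => //; exact: cvg_cst.
have mcvg := cvg_comp _ _ (cvgD zcvg (cvg_shift _ _ _ ycvg))
  (@mulmxr_continuous R p n B^T _).
have gcvg := cvg_comp _ _ xcvg (F1.2 xb).
have glim := cvgD (cvgD gcvg (cvg_shift _ _ _ xcvg)) (mcvg _).
have : (fun=> 0 : 'rV[R]_n) @ \oo --> grad F xb + 2 *: (xb - xb)
    + (zeta + 2 *: (xb *m B - xb *m B)) *m B^T.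
  apply: (cvg_trans _ (glim _ _ _)). apply: near_eq_cvg; near=> k.
  by have [_ _ _ _] := ht (phi k).
move=> /(cvg_unique (@norm_hausdorff _ _) (cvg_cst _)).
rewrite !subrr !scaler0 !addr0 => /esym/eqP; rewrite addrC addr_eq0 => /eqP ->.
by [].
Unshelve. all: by end_near. Qed.

End Multiplier.

(** * Domain of an inner semicompact mapping *)

(** Inner semicompactness forces a uniform bound: near zb every z in dom K has
    some lambda in K z of norm at most k, since otherwise points violating this
    for k = 0, 1, 2, ... could be chosen to converge to zb without admitting a
    bounded subsequence of images.  So dom K is, near zb, the projection of a
    compact part of the graph. *)
Lemma dom_locally_closed (R : realType) (n m : nat)
    (K : 'rV[R]_n -> set 'rV[R]_m) (zb : 'rV[R]_n) :
  closed (gph K) -> inner_semicompact K zb -> locally_closed (dom K) zb.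
Proof.
move=> cK [_ isc].
have [k kP] : exists k : nat, forall z, `|zb - z| <= k.+1%:R^-1 -> dom K z ->
    exists2 l, K z l & enorm l <= k%:R.
  apply: contrapT => /forallNP nk.
  have /choice[z_ zP] : forall k : nat, exists z, [/\ `|zb - z| <= k.+1%:R^-1,
      dom K z & forall l, K z l -> k%:R < enorm l].
    move=> k; have /existsNP[z /not_implyP[zk /not_implyP[Kz nl]]] := nk k.
    exists z; split => // l Kl; rewrite ltNge; apply/negP => lk.
    by apply: nl; exists l.
  have zcvg : z_ @ \oo --> zb.
    apply/cvgrPdist_le => e e0; near=> k; have [zk _ _] := zP k.
    rewrite (le_trans zk)//; apply: ltW; near: k.
    exact: near_infty_natSinv_lt (PosNum e0).
  have [|l_ [Kl [phi [hphi [C lC]]]]] := isc z_ _ zcvg.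
    by move=> k; have [] := zP k.
  have phik : forall k, (k <= phi k)%N.
    by elim=> // k IH; exact: leq_ltn_trans IH (hphi _ _ (ltnSn k)).
  pose N := (Num.trunc `|C|).+1.
  have CN : C < N%:R by rewrite (le_lt_trans (ler_norm C))// truncnS_gt.
  have [_ _ /(_ _ (Kl (phi N)))] := zP (phi N).
  apply/negP; rewrite -leNgt (le_trans (lC N))// (le_trans (ltW CN))//.
  by rewrite ler_nat.
pose r : R := k.+1%:R^-1.
exists [set z | `|zb - z| <= r]; first by apply: near_norm_le; rewrite invr_gt0.
pose S := [set x : 'rV[R]_(n + m) | `|row_mx zb 0 - x| <= Num.max r k%:R] `&`
  (gph K `&` lsubmx @^-1` [set z | `|zb - z| <= r]).
have -> : dom K `&` [set z | `|zb - z| <= r] = lsubmx @` S.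
  apply/seteqP; split => [z [Kz zr]|_ [x [_ [Kx xr]] <-]].
    have [l Kzl lk] := kP z zr Kz.
    exists (row_mx z l); last by rewrite row_mxKl.
    split; last by split; rewrite /gph /= ?row_mxKl ?row_mxKr.
    rewrite /= opp_row_mx add_row_mx sub0r (le_trans (norm_row_mx_le _ _))//.
    by rewrite normrN ge_max !le_max zr (le_trans (norm_le_enorm _) lk) orbT.
  by split => //; exists (rsubmx x).
apply: compact_closed; first exact: norm_hausdorff.
apply: continuous_compact.
  by apply: continuous_subspaceT => x; exact: continuous_lsubmx.
apply: compact_closedI; first exact: compact_sup_ball.
apply: closedI => //; apply: closed_comp => [x _|].
  exact: continuous_lsubmx.
by apply: compact_closed; [exact: norm_hausdorff|exact: compact_sup_ball].
Unshelve. all: by end_near. Qed.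

(** * Stationarity conditions *)

(** Normals to a product are pairs (u, v), so for B = (L | 1) the image
    zeta B^T of the multiplier is u L^T + v. *)
Lemma split_multiplier (R : realType) (N n : nat) (f : 'rV[R]_n -> R)
    (L : 'M[R]_(N, n)) (M : set 'rV[R]_n) (G : set 'rV[R]_N) (xb : 'rV[R]_N) :
  continuously_differentiable f -> closed M -> locally_closed G xb ->
  local_minimizer (fun x => f (x *m L)) [set x | M (x *m L) /\ G x] xb ->
  metrically_subregular
    (fun x => [set row_mx (x *m L) x - p | p in prodv M G]) xb 0 ->
  exists u v, [/\ limiting_normal_cone M (xb *m L) u,
    limiting_normal_cone G xb v &
    - grad f (xb *m L) *m L^T = u *m L^T + v].
Proof.
move=> f1 cM cG fmin sub; pose B : 'M[R]_(N, n + N) := row_mx L 1%:M.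
have BE x : x *m B = row_mx (x *m L) x by rewrite mul_mx_row mulmx1.
have [|||zeta Nz] := @limiting_multiplier R N _ (fun x => f (x *m L)) B
    (prodv M G) xb (C1_mulmx L f1).
- rewrite BE; apply: locally_closed_prodv => //.
  exact: closed_locally_closed.
- rewrite (_ : [set _ | _] = [set x | M (x *m L) /\ G x])//.
  by apply/seteqP; split => x /=; rewrite BE prodv_row_mx.
- by under eq_fun do rewrite BE.
rewrite (grad_mulmx (f1.1 (xb *m L))).2 BE in Nz *.
have [Nu Nv] := limiting_normal_prodv Nz; rewrite row_mxKl row_mxKr in Nu Nv.
move=> H; exists (lsubmx zeta), (rsubmx zeta); split => //.
by rewrite mulNmx H -[in LHS](hsubmxK zeta) tr_row_mx trmx1 mul_row_col mulmx1.
Qed.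

Theorem theorem4p16 (R : realType) (n m : nat) (f : 'rV[R]_n -> R)
    (M : set 'rV[R]_n) (K : 'rV[R]_n -> set 'rV[R]_m) (zb : 'rV[R]_n)
    (f_C1 : continuously_differentiable f)
    (M_closed : closed M)
    (K_closed : closed (gph K))
    (zb_feasible : feasibleP M K zb)
    (K_isc : inner_semicompact K zb) :
  (implicit_local_minimizer f M K zb ->
     abstractly_M_stationary f M K zb) /\
  (implicit_local_minimizer f M K zb ->
     metrically_subregular (Upsilon_imp M K) zb 0 ->
     implicitly_M_stationary f M K zb) /\
  (forall lb : 'rV[R]_m, K zb lb ->
     local_minimizerQ f M K zb lb ->
     metrically_subregular (Upsilon_exp M K) (row_mx zb lb) 0 ->
     explicitly_M_stationary_wrt f M K zb lb) /\
  (explicit_local_minimizer f M K zb ->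
     (forall lb : 'rV[R]_m, K zb lb ->
        metrically_subregular (Upsilon_exp M K) (row_mx zb lb) 0) ->
     explicitly_M_stationary f M K zb).
Proof.
have expl lb : K zb lb -> local_minimizerQ f M K zb lb ->
    metrically_subregular (Upsilon_exp M K) (row_mx zb lb) 0 ->
    explicitly_M_stationary_wrt f M K zb lb.
  (* L is the projection (z, lambda) |-> z, so L^T embeds z as (z, 0): the
     second component of the multiplier equation puts v in the form (xs, 0). *)
  move=> _ fmin sub; pose L : 'M[R]_(n + m, n) := col_mx 1%:M 0.
  have LE x : x *m L = lsubmx x.
    by rewrite -[x in LHS]hsubmxK mul_row_col mulmx1 mulmx0 addr0.
  have [||u [v [Nu Nv]]] := @split_multiplier R _ _ f L M (gph K) (row_mx zb lb)
      f_C1 M_closed (closed_locally_closed _ K_closed).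
  - rewrite (_ : [set x | _] = feasibleQ M K); last first.
      by apply/seteqP; split => x /=; rewrite LE.
    by under eq_fun do rewrite LE.
  - by under eq_fun do rewrite LE.
  rewrite LE row_mxKl in Nu *; rewrite /L tr_col_mx trmx1 trmx0 !mul_mx_row.
  rewrite !mulmx1 !mulmx0 => /eqP; rewrite addrC -subr_eq => /eqP vE.
  exists u => //; exists (- grad f zb - u); last by rewrite addrC subrK.
  rewrite /coderivative /= oppr0; move: Nv; rewrite -vE opp_row_mx add_row_mx.
  by rewrite subr0.
split=> [fmin|]; last split=> [fmin sub|];
  last split=> // [[_ fmin] sub lb Klb].
- apply: regular_limiting_normal => //; apply: fermat_regular_normal fmin.
  exact: differentiable_has_gradient (f_C1.1 zb).
- have [||u [v [Nu Nv]]] := @split_multiplier R _ _ f 1%:M M (dom K) zb f_C1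
    M_closed (dom_locally_closed K_closed K_isc).
  - rewrite (_ : [set x | _] = feasibleP M K); last first.
      by apply/seteqP; split => x /=; rewrite mulmx1.
    by under eq_fun do rewrite mulmx1.
  - by under eq_fun do rewrite mulmx1.
  rewrite trmx1 !mulmx1 in Nu * => gE; rewrite /implicitly_M_stationary gE.
  by exists u => //; exists v.
- by apply: expl => //; [exact: fmin|exact: sub].
Qed.
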